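(* Let $\Omega=\{\omega_1,\omega_2\}$, $\mathcal F=2^\Omega$, $X(\omega_1)=1$, $X(\omega_2)=0$. Let $\phi$ be a divergence function such that $[1-\delta,1+\delta]\subseteq \mathrm{int}(\mathrm{dom}(\phi))$ for some $\delta>0$ and $\lim_{x\to\infty}\phi(x)/x<\infty$, and let $\tau>0$. Then there exist constants $r_{\phi,\tau}>0$ and $p_{\phi,\tau}>0$, depending only on $\phi$ and $\tau$, with the property that $\mathcal R(X)\ge r_{\phi,\tau}$ for every probability measure $P$ on $(\Omega,\mathcal F)$ with $0<P(\omega_1)\le p_{\phi,\tau}$, and such that the following holds: for any $p\in(0,p_{\phi,\tau})$, any positive integer $n\le 1/(2p)$, and any estimator $\hat{\mathcal R}_n(X):\Omega^n\to\mathbb R$ that is $\mathcal F^{\otimes n}$-measurable (a function of $n$ i.i.d. samples), there exists a probability measure $P$ on $(\Omega,\mathcal F)$ such that $$P^{\otimes n}\Big(\big|\hat{\mathcal R}_n(X)-\mathcal R^P(X)\big|\ge \tfrac{r_{\phi,\tau}}{2}\Big)\ge \tfrac14 .$$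
   Context: A divergence function is a convex lower semicontinuous $\phi:\mathbb R\to[0,\infty]$ with $\phi(1)=0$ and $\phi(x)=+\infty$ for $x<0$. For a probability measure $P$ on a measurable space $(\Omega,\mathcal F)$, a radius $\tau$ and a bounded measurable $X:\Omega\to\mathbb R$, the distributionally robust functional is $$\mathcal R(X)=\mathcal R^P(X)=\sup\Big\{\int_\Omega X\zeta\,dP:\ \zeta\ge 0 \text{ measurable},\ \int_\Omega\zeta\,dP=1,\ \int_\Omega\phi(\zeta)\,dP\le\tau\Big\}.$$ The limit $\lim_{x\to\infty}\phi(x)/x$ always exists in $[0,\infty]$. *)

(* Defs.v *)
From HB Require Import structures.
From mathcomp Require Import all_boot all_order all_algebra.
From mathcomp Require Import all_classical all_reals all_analysis.
Import Order.TTheory GRing.Theory Num.Theory.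
Import numFieldNormedType.Exports.

Set Implicit Arguments.
Unset Strict Implicit.
Unset Printing Implicit Defensive.

Local Open Scope classical_set_scope.
Local Open Scope ring_scope.
Local Open Scope ereal_scope.

(* At [t = 0] and [t = 1] the library's convention [0 * +oo = 0] makes the
   inequality trivial, so this is the usual convexity for values in
   ]-oo, +oo]. *)
Definition ereal_convex (R : realType) (f : R -> \bar R) : Prop :=
  forall (x y t : R), (0 <= t <= 1)%R ->
    f (t * x + (1 - t) * y)%R <= t%:E * f x + (1 - t)%:E * f y.

Record divergence_function (R : realType) (phi : R -> \bar R) : Prop := {
  divergence_ge0 : forall x, 0 <= phi x ;
  divergence_convex : ereal_convex phi ;
  divergence_lsc : lower_semicontinuous phi ;
  divergence_1 : phi 1%R = 0 ;
  divergence_lt0 : forall x, (x < 0)%R -> phi x = +oo }.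

Definition effective_domain (R : realType) (phi : R -> \bar R) : set R :=
  [set x | phi x < +oo].

Definition feasible_density d (T : measurableType d) (R : realType)
    (phi : R -> \bar R) (tau : R) (P : probability T R) (zeta : T -> R) : Prop :=
  [/\ measurable_fun setT zeta,
      forall w, (0 <= zeta w)%R,
      \int[P]_w (zeta w)%:E = 1 &
      \int[P]_w phi (zeta w) <= tau%:E].

Definition robust d (T : measurableType d) (R : realType)
    (phi : R -> \bar R) (tau : R) (P : probability T R) (X : T -> R) : \bar R :=
  ereal_sup [set \int[P]_w (X w * zeta w)%:E | zeta in
    [set zeta | feasible_density phi tau P zeta]].

Definition cons_pair (T : Type) (n : nat) (x : T * n.-tuple T) : n.+1.-tuple T :=
  [tuple of x.1 :: x.2].

Lemma measurable_cons_pair d (T : measurableType d) (n : nat) :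
  measurable_fun setT (@cons_pair T n).
Proof. exact: measurable_cons. Qed.

HB.instance Definition _ d (T : measurableType d) (n : nat) :=
  isMeasurableFun.Build _ _ _ _ (@cons_pair T n) (@measurable_cons_pair d T n).

(* The n-fold product P^{(x) n} on the library's product sigma-algebra of
   [n.-tuple T], obtained by transporting [P \x P^{(x) n}] along [cons_pair];
   [iid_box] checks it on measurable boxes, which determine it. *)
Fixpoint iid d (T : measurableType d) (R : realType) (P : probability T R)
    (n : nat) : probability (n.-tuple T) R :=
  match n with
  | 0%N => dirac [tuple]
  | m.+1 => distribution (P \x iid P m) (@cons_pair T m)
  end.

Lemma measurable_box d (T : measurableType d) (n : nat) (A : 'I_n -> set T) :
  (forall i, measurable (A i)) ->
  measurable [set s : n.-tuple T | forall i, A i (tnth s i)].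
Proof.
move=> mA.
rewrite (_ : [set _ | _] =
    \bigcap_(i in [set: 'I_n]) ((@tnth n T)^~ i @^-1` A i)); last first.
  by apply/seteqP; split=> s /= h i; [move=> _|]; exact: h.
apply: fin_bigcap_measurable; first exact: finite_finset.
move=> i _; rewrite -[X in measurable X]setTI.
exact: (measurable_tnth i measurableT (mA i)).
Qed.

Lemma iid_box d (T : measurableType d) (R : realType) (P : probability T R)
    (n : nat) (A : 'I_n -> set T) :
  (forall i, measurable (A i)) ->
  iid P n [set s | forall i, A i (tnth s i)] = \prod_(i < n) P (A i).
Proof.
elim: n A => [|n IH] A mA.
  rewrite big_ord0 /= diracE mem_set// => -[]//.
rewrite big_ord_recl /= /distribution /pushforward /=.
rewrite (_ : _ @^-1` _ =
    A ord0 `*` [set s : n.-tuple T | forall i, A (lift ord0 i) (tnth s i)]).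
  rewrite product_measure1E //; last first.
    by apply: (@measurable_box _ T n (fun i => A (lift ord0 i))) => i; exact: mA.
  by congr (_ * _); apply: (IH (fun i => A (lift ord0 i))) => i; exact: mA.
apply/seteqP; split=> -[x s] /=.
  move=> h; split; first by have := h ord0; rewrite /cons_pair tnth0.
  by move=> i; have := h (lift ord0 i); rewrite /cons_pair tnthS.
move=> [h0 h] i; rewrite /cons_pair.
by case: (unliftP ord0 i) => [j|] ->; rewrite ?tnth0 ?tnthS.
Qed.

(* The two-point space {omega_1, omega_2} is [bool], whose library
   sigma-algebra is the full power set; omega_1 is [true]. *)
Definition omega1_indicator (R : realType) (w : bool) : R := w%:R.

(* Main.v *)
(** A feasible density may put a fixed mass [r] on [omega_1], however small
    [P omega_1] is: linear growth of [phi] bounds the price of the large value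
    [r / P omega_1] by [C r], and convexity bounds the price of the value
    slightly below [1] taken at [omega_2].  Hence [robust] jumps from [0] at the
    Dirac mass on [omega_2] to at least [r] at [P omega_1 = q].  A sample of size
    [n <= 1 / (2 q)] consists of [omega_2] only with probability at least [1/2]
    under both laws, so the value of the estimator on that single sample is off
    by [r / 2] for one of them. *)
Require Import Defs.
From mathcomp Require Import all_boot all_order all_algebra.
From mathcomp Require Import all_classical all_reals all_analysis.
From mathcomp Require Import ring lra.
Import Order.TTheory GRing.Theory Num.Theory.
Import numFieldNormedType.Exports.

Local Open Scope classical_set_scope.
Local Open Scope ring_scope.
Local Open Scope ereal_scope.

Section divergence.
Context {R : realType} {phi : R -> \bar R}.
Hypothesis phi_div : divergence_function phi.

Lemma divergence_segment (x t : R) : (0 <= t <= 1)%R ->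
  phi (t * x + (1 - t))%R <= t%:E * phi x.
Proof.
move=> t01; have := divergence_convex phi_div x 1%R t01.
by rewrite divergence_1// mule0 adde0 mulr1.
Qed.

(** The point [y] is the convex combination of [x] and [1] with weight (y - 1) / (x - 1) on [x], and
    this weight is at most y / x. So phi(x) / x is nondecreasing on [1, +oo[. *)
Lemma divergence_ratio_mono (x y : R) : (1 <= y)%R -> (y <= x)%R ->
  phi y <= (y / x)%:E * phi x.
Proof.
move=> y1 yx; have phi0 := divergence_ge0 phi_div x.
have x0 : (0 < x)%R by lra.
case: (eqVneq x 1%R) => [x1|xn1].
  have -> : y = 1%R by lra.
  rewrite divergence_1//; apply: mule_ge0 => //.
  by rewrite lee_fin divr_ge0// ltW.
have x1 : (0 < x - 1)%R by rewrite subr_gt0 lt_neqAle eq_sym xn1; lra.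
pose t := ((y - 1) / (x - 1))%R.
have t01 : (0 <= t <= 1)%R.
  by apply/andP; split; rewrite /t ?divr_ge0 ?ler_pdivrMr//; lra.
have {1}-> : y = (t * x + (1 - t))%R.
  by rewrite /t; field; rewrite subr_eq0.
apply: le_trans (divergence_segment _ _ t01) _.
apply: lee_wpmul2r => //.
rewrite lee_fin /t ler_pdivrMr// mulrAC ler_pdivlMr//; nra.
Qed.

(** If no [C] works, the ratio phi(x) / x exceeds every [A] at some point of [1, +oo[; by
    monotonicity it stays above [A] from there on, so the limit is [+oo]. *)
Lemma divergence_linear_growth :
  lim (phi x * (x^-1)%R%:E @[x --> +oo%R]) < +oo ->
  exists2 C : R, (0 <= C)%R & forall x, (1 <= x)%R -> phi x <= (C * x)%:E.
Proof.
move=> lim_fin; apply: contrapT => no_bound.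
have large A : exists2 x, (1 <= x)%R & (A * x)%:E < phi x.
  apply: contrapT => no_x; apply: no_bound; exists (Num.max A 0)%R.
    by rewrite le_max lexx orbT.
  move=> x x1; rewrite leNgt; apply/negP => phi_x; apply: no_x; exists x => //.
  apply: le_lt_trans phi_x; rewrite lee_fin; apply: ler_wpM2r; first lra.
  by rewrite le_max lexx.
suff lim_oo : phi x * (x^-1)%R%:E @[x --> +oo%R] --> +oo.
  by move: lim_fin; rewrite (cvg_lim _ lim_oo)// ltxx.
apply/cvgeyPge => A; have [y y1 phi_y] := large A.
near=> x.
have yx : (y <= x)%R by near: x; apply: nbhs_pinfty_ge; rewrite num_real.
have x0 : (0 < x)%R by lra.
have := divergence_ratio_mono _ _ y1 yx.
move: (divergence_ge0 phi_div x); case: (phi x) => [v v0|_|]//; last first.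
  by rewrite gt0_mulye ?leey// lte_fin invr_gt0.
move=> /(lt_le_trans phi_y); rewrite lte_fin mulrAC -mulrA => Ay.
rewrite lee_fin ler_pdivlMr//.
have {}Ay : (A * y < y * (v / x))%R by rewrite mulrC in Ay *; lra.
have : (A < v / x)%R by rewrite mulrC ltr_pM2l// in Ay; lra.
by rewrite ltr_pdivlMr// => /ltW.
Unshelve. all: by end_near.
Qed.

End divergence.

Lemma probability_boolE {R : realType} (P : probability bool R) (p : R)
    (f : bool -> \bar R) : P [set true] = p%:E -> (forall b, 0 <= f b) ->
  \int[P]_b f b = p%:E * f true + (1 - p)%:E * f false.
Proof.
move=> Pp f0; have p01 : (0 <= p <= 1)%R.
  by rewrite -!lee_fin -Pp measure_ge0 probability_le1.
rewrite -integral_bernoulli_prob//; apply: eq_measure_integral => A _ _.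
exact: eq_bernoulli.
Qed.

Section robust_indicator.
Context {R : realType} (phi : R -> \bar R) (tau : R) (P : probability bool R).
Hypothesis phi_div : divergence_function phi.

Lemma robust_omega1_ge {r p C d D : R} :
  (forall x, (1 <= x)%R -> phi x <= (C * x)%:E) ->
  (0 < d)%R -> phi (1 - d)%R = D%:E -> (0 <= D)%R -> (0 < r)%R ->
  (r <= d)%R -> (r <= 1)%R -> (C * r + r / d * D <= tau)%R ->
  P [set true] = p%:E -> (0 < p)%R -> (p <= r)%R -> (p < 1)%R ->
  r%:E <= robust phi tau P (@omega1_indicator R).
Proof.
move=> phiC d0 phiD D0 r0 rd r1 cost Pp p0 pr p1.
have q0 : (0 < 1 - p)%R by lra.
(* The values that give mass [r] to omega_1 and [1 - r] to omega_2. As [p <= r], [a] lies in the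
   range of the linear bound. *)
pose a := (r / p)%R; pose b := ((1 - r) / (1 - p))%R.
have pa : (p * a = r)%R by rewrite /a; field; lra.
have qb : ((1 - p) * b = 1 - r)%R by rewrite /b; field; lra.
have a1 : (1 <= a)%R by rewrite ler_pdivlMr//; lra.
have b0 : (0 <= b)%R by rewrite divr_ge0//; lra.
have phi0 := divergence_ge0 phi_div.
have phib : phi b <= (r / d * D)%:E.
  (* Here 1 - b = (r - p) / (1 - p) lies in [0, r], so [b] is on the segment from [1 - d] to [1],
     with weight at most r / d on [1 - d]. *)
  pose t := ((1 - b) / d)%R.
  have bt : b = (t * (1 - d) + (1 - t))%R by rewrite /t; field; lra.
  have b1 : (1 - b <= r)%R by nra.
  have bge : (0 <= 1 - b)%R by nra.
  have t01 : (0 <= t <= 1)%R.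
    by apply/andP; split; rewrite /t ?divr_ge0 ?ler_pdivrMr//; lra.
  rewrite bt; apply: le_trans (divergence_segment phi_div _ _ t01) _.
  rewrite phiD -EFinM lee_fin; apply: ler_wpM2r => //.
  by apply: ler_wpM2r => //; rewrite invr_ge0 ltW.
pose zeta (w : bool) := if w then a else b.
have zeta0 w : (0 <= zeta w)%R by case: w => //=; lra.
apply: ereal_sup_ubound; exists zeta; last first.
  rewrite (probability_boolE _ _ _ Pp)//=; last first.
    by case; rewrite /omega1_indicator lee_fin mulr_ge0.
  by rewrite /omega1_indicator mul1r mul0r mule0 adde0 -EFinM pa.
split=> //.
- rewrite (probability_boolE _ _ _ Pp)//= -!EFinM pa qb -EFinD.
  by congr EFin; lra.
- rewrite (probability_boolE _ _ _ Pp)//=.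
  apply: (@le_trans _ _ (p%:E * (C * a)%:E + (1 - p)%:E * (r / d * D)%:E)).
    by apply: leeD; apply: lee_wpmul2l; rewrite ?lee_fin ?phiC//; lra.
  rewrite -!EFinM -EFinD lee_fin.
  have rdD : (0 <= r / d * D)%R by rewrite mulr_ge0// divr_ge0//; lra.
  (* The weight [p] cancels the 1 / p in [a], so the bound on the price does not depend on [p]; the
     weight [1 - p] is bounded by 1. *)
  have -> : (p * (C * a) = C * r)%R by rewrite -pa; ring.
  nra.
Qed.

Lemma robust_omega1_eq0 : (0 < tau)%R -> P [set true] = 0 ->
  robust phi tau P (@omega1_indicator R) = 0.
Proof.
move=> tau0 P0; rewrite /robust (_ : [set _ | _ in _] = [set 0]) ?ereal_sup1//.
have int0 (zeta : bool -> R) : (forall w, (0 <= zeta w)%R) ->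
    \int[P]_w (omega1_indicator R w * zeta w)%:E = 0.
  move=> zeta0; rewrite (probability_boolE _ _ _ P0)//=; last first.
    by case; rewrite /omega1_indicator lee_fin mulr_ge0.
  by rewrite /omega1_indicator mul0r mul0e mule0 adde0.
apply/seteqP; split=> [_ [zeta [_ zeta0 _ _] <-]|_ ->]; first exact: int0.
(* A feasible density is needed, because the supremum of the empty set is [-oo]. *)
exists (cst 1%R) => /=; last by apply: int0 => w; exact: ler01.
split=> //.
- by rewrite (probability_boolE _ _ _ P0)//= mul0e add0e subr0 mul1e.
- rewrite (probability_boolE _ _ _ P0)//=; last first.
    by move=> _; exact: divergence_ge0.
  by rewrite divergence_1// !mule0 adde0 lee_fin ltW.
Qed.

End robust_indicator.

(** Every set of tuples is a finite union of singletons, and a singleton is a box. *)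
Lemma measurable_tuple_bool (n : nat) (A : set (n.-tuple bool)) : measurable A.
Proof.
rewrite (_ : A = \bigcup_(t in A) [set s | forall i, tnth s i = tnth t i]).
  apply: fin_bigcup_measurable => [|t _]; first exact: finite_finset.
  exact: (@measurable_box _ bool n (fun i => [set tnth t i])).
apply/seteqP; split=> [s As|s [t At /eq_from_tnth->]//].
by exists s.
Qed.

(** The singleton of the all-[false] sample is a box of mass (1 - p)^n contained in [E]. *)
Lemma iid_all_false_ge {R : realType} (P : probability bool R) (p : R) (n : nat)
    (E : set (n.-tuple bool)) : P [set true] = p%:E ->
  E [tuple of nseq n false] -> ((1 - p) ^+ n)%:E <= iid P n E.
Proof.
move=> Pp Efalse.
have Pfalse : P [set false] = (1 - p)%:E.
  rewrite (_ : [set false] = ~` [set true]) ?probability_setC// ?Pp//.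
  by apply/seteqP; split=> -[]//=.
have <- : iid P n [set s | forall i, [set false] (tnth s i)] = ((1 - p) ^+ n)%:E.
  rewrite (@iid_box _ bool R P n (fun=> [set false]))// Pfalse.
  by rewrite prodEFin prodr_const card_ord.
apply: le_measure; rewrite ?inE; try exact: measurable_tuple_bool.
move=> s /= s_false; rewrite (_ : s = [tuple of nseq n false])//.
by apply: eq_from_tnth => i; rewrite s_false (tnth_nth false)/= nth_nseq ltn_ord.
Qed.

Lemma bernoulli_ineq {R : realType} (p : R) (n : nat) : (0 <= p <= 1)%R ->
  (1 - n%:R * p <= (1 - p) ^+ n)%R.
Proof.
move=> p01; elim: n => [|n IH]; first by rewrite expr0; lra.
rewrite exprS -natr1; have := ler0n R n; nra.
Qed.

Theorem theorem2p2 (R : realType) (phi : R -> \bar R) (tau : R)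
  (phi_div : divergence_function phi)
  (phi_int : exists2 delta : R, (0 < delta)%R &
     `[(1 - delta)%R, (1 + delta)%R] `<=` (effective_domain phi)°)
  (phi_lim : lim (phi x * (x^-1)%R%:E @[x --> +oo%R]) < +oo)
  (tau_gt0 : (0 < tau)%R) :
  exists r p : R,
    [/\ (0 < r)%R, (0 < p)%R,
        forall P : probability bool R,
          0 < P [set true] <= p%:E ->
          r%:E <= robust phi tau P (@omega1_indicator R) &
        forall (q : R) (n : nat) (Rhat : n.-tuple bool -> R),
          (0 < q < p)%R -> (0 < n)%N -> (n%:R <= 1 / (2 * q))%R ->
          measurable_fun setT Rhat ->
          exists P : probability bool R,
            (4^-1)%:E <= iid P n
              [set s | (r / 2)%:E <=
                 `|(Rhat s)%:E - robust phi tau P (@omega1_indicator R)| ]].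
Proof.
have [C C0 phiC] := divergence_linear_growth phi_div phi_lim.
have [d d0 dom_d] := phi_int.
have [D D0 phiD] : exists2 D : R, (0 <= D)%R & phi (1 - d)%R = D%:E.
  have : phi (1 - d)%R < +oo.
    by apply: (@interior_subset _ (effective_domain phi)); apply: dom_d;
      rewrite /= in_itv/=; lra.
  have := divergence_ge0 phi_div (1 - d)%R.
  by case: (phi _) => [v|//|//]; rewrite lee_fin => v0 _; exists v.
(* The total price is r (C + D / d), so [r <= tau / K] keeps it within [tau]; the summand 1 makes
   [K] positive even if [C] and [D] vanish. *)
pose K := (C + D / d + 1)%R.
have Dd0 : (0 <= D / d)%R by rewrite divr_ge0// ltW.
have K0 : (0 < K)%R by rewrite /K; lra.
pose r := (Num.min (Num.min d 1) (tau / K))%R.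
have r0 : (0 < r)%R by rewrite !lt_min d0 ltr01 divr_gt0.
have rd : (r <= d)%R by rewrite !ge_min lexx.
have r1 : (r <= 1)%R by rewrite !ge_min lexx !orbT.
have cost : (C * r + r / d * D <= tau)%R.
  have : (r <= tau / K)%R by rewrite !ge_min lexx !orbT.
  rewrite ler_pdivlMr// /K => rK.
  have -> : (C * r + r / d * D = r * (C + D / d))%R by ring.
  nra.
have robust_ge (P : probability bool R) (p : R) : P [set true] = p%:E -> (0 < p)%R -> (p <= r / 2)%R ->
    r%:E <= robust phi tau P (@omega1_indicator R).
  move=> Pp p0 pr.
  by apply: (robust_omega1_ge _ _ _ phi_div phiC d0 phiD D0 r0 rd r1 cost Pp p0);
    lra.
(* Since [r <= 1], a mass of at most r / 2 on omega_1 is both below [r] and below 1. *)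
exists r, (r / 2)%R; split=> //; first lra.
  move=> P /andP[P0 Pr]; have Pfin : P [set true] \is a fin_num.
    by rewrite fin_num_measure.
  by apply: (robust_ge P (fine (P [set true]))); rewrite ?fineK// -?lte_fin
    -?lee_fin ?fineK.
move=> q n Rhat /andP[q0 qr] _ nq _.
pose s0 := [tuple of nseq n false].
(* An estimate far from 0 at [s0] errs under the law with no mass on omega_1; one near 0 errs under
   the law with mass [q]. *)
have [s0_far|s0_near] := leP (r / 2)%R `|Rhat s0|%R.
  pose P0 : probability bool R := bernoulli_prob 0%R.
  have P00 : P0 [set true] = 0%R%:E.
    rewrite /P0/= bernoulli_probE ?lexx ?ler01// mul0e add0e.
    by rewrite diracE memNset// mule0.
  exists P0; rewrite robust_omega1_eq0//.
  apply: le_trans (iid_all_false_ge _ _ _ _ P00 _).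
    by rewrite subr0 expr1n lee_fin; lra.
  by rewrite /mkset sube0 lee_fin.
pose P1 : probability bool R := bernoulli_prob q.
have P1q : P1 [set true] = q%:E.
  rewrite /P1/= bernoulli_probE; last lra.
  by rewrite !diracE mem_set// memNset// mule1 mule0 adde0.
exists P1; apply: le_trans (iid_all_false_ge _ _ _ _ P1q _).
  (* As n q is at most 1 / 2, the sample [s0] has mass at least 1 / 2. *)
  rewrite lee_fin; have := @bernoulli_ineq R q n; rewrite ler_pdivlMr in nq.
    by move=> /(_ ltac:(lra)); lra.
  lra.
have := robust_ge P1 q P1q q0 (ltW qr).
(* If the robust value is [+oo], so is the error; [-oo] is excluded by the lower bound [r]. *)
move: (robust _ _ _ _) => [v||//]/=; last by rewrite !leey.
rewrite !lee_fin => rv; move: s0_near; rewrite ltr_norml => /andP[_ s0r].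
by rewrite distrC ler_normr; apply/orP; left; lra.
Qed.
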